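(* If a locally finite hyperbolic graph admits a vertex-transitive group of automorphisms fixing a point at infinity, then it is quasi-isometric to a regular tree; in particular it cannot be one-ended.
   Context: Graphs are connected and endowed with the graph metric; a graph is hyperbolic if this metric is Gromov-hyperbolic. A point at infinity is a point of the visual (Gromov) boundary of the graph. *)

(* Defs.v *)
From HB Require Import structures.
From mathcomp Require Import all_boot all_order all_algebra.
From mathcomp Require Import all_classical all_reals all_analysis.

Set Implicit Arguments.
Unset Strict Implicit.
Unset Printing Implicit Defensive.

Import Order.TTheory GRing.Theory Num.Theory.
Import numFieldNormedType.Exports.

Local Open Scope classical_set_scope.
Local Open Scope card_scope.
Local Open Scope ring_scope.

(* Connected simple graphs, possibly infinite. Classically, asking for an
   [eqType] and a boolean adjacency relation is no restriction. *)
Record graph := Graph {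
  vertex :> eqType;
  adj : rel vertex;
  adj_sym : symmetric adj;
  adj_irr : irreflexive adj;
  graph_connected : forall x y : vertex,
    exists p : seq vertex, path adj x p /\ last x p = y }.

Definition walk_of_length (X : graph) (x y : X) (n : nat) : Prop :=
  exists p : seq X, [/\ path (@adj X) x p, last x p = y & size p = n].

Lemma walk_exists (X : graph) (x y : X) :
  exists n, `[< walk_of_length x y n >].
Proof.
have [p [hp hl]] := graph_connected x y.
by exists (size p); apply/asboolP; exists p.
Qed.

Definition dist (X : graph) (x y : X) : nat := ex_minn (walk_exists x y).

Definition locally_finite (X : graph) : Prop :=
  forall x : X, finite_set [set y | adj x y].

Definition gromov_product (R : realType) (X : graph) (o x y : X) : R :=
  ((dist x o)%:R + (dist y o)%:R - (dist x y)%:R) / 2.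

Definition hyperbolic (R : realType) (X : graph) : Prop :=
  exists delta : R, forall o x y z : X,
    Num.min (gromov_product R o x y) (gromov_product R o y z) - delta
      <= gromov_product R o x z.

(* Gromov products at two base points differ by at most the distance between
   these, so quantifying over all of them avoids choosing one. *)
Definition gromov_equiv (R : realType) (X : graph) (u v : nat -> X) : Prop :=
  forall o : X,
    gromov_product R o (u p.1) (v p.2) @[p --> filter_prod \oo \oo] --> +oo.

Definition gromov_sequence (R : realType) (X : graph) (u : nat -> X) : Prop :=
  gromov_equiv R u u.

(* A point at infinity is an equivalence class of Gromov sequences. *)
Definition boundary (R : realType) (X : graph) : set (set (nat -> X)) :=
  [set xi | exists2 u : nat -> X, gromov_sequence R u &
    xi = [set v | gromov_sequence R v /\ gromov_equiv R u v]].
Arguments boundary : clear implicits.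

Definition automorphism (X : graph) (f : X -> X) : Prop :=
  bijective f /\ forall x y : X, adj (f x) (f y) = adj x y.

Definition automorphism_group (X : graph) (H : set (X -> X)) : Prop :=
  [/\ forall f, H f -> automorphism f,
      H id,
      forall f g, H f -> H g -> H (f \o g) &
      forall f, H f -> exists g, [/\ H g, cancel f g & cancel g f]].

Definition vertex_transitive (X : graph) (H : set (X -> X)) : Prop :=
  forall x y : X, exists2 f, H f & f x = y.

Definition fixes_at_infinity (X : graph) (H : set (X -> X))
    (xi : set (nat -> X)) : Prop :=
  forall f, H f -> [set f \o u | u in xi] = xi.

Definition quasi_isometric (R : realType) (X Y : graph) : Prop :=
  exists (f : X -> Y) (L C : R),
    [/\ 1 <= L, 0 <= C,
        forall x y : X,
          L^-1 * (dist x y)%:R - C <= (dist (f x) (f y))%:R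
            <= L * (dist x y)%:R + C &
        forall y : Y, exists x : X, (dist y (f x))%:R <= C].

(* A closed walk x y x of length 2 is a [cycle] in the sense of the library. *)
Definition tree (T : graph) : Prop :=
  forall s : seq T, cycle (@adj T) s -> uniq s -> (size s <= 2)%N.

Definition regular (d : nat) (X : graph) : Prop :=
  forall x : X, [set y | adj x y] #= `I_d.

Definition ray (X : graph) (u : nat -> X) : Prop :=
  injective u /\ forall n, adj (u n) (u n.+1).

Definition connected_off (X : graph) (K : set X) (x y : X) : Prop :=
  exists p : seq X,
    [/\ path (@adj X) x p, last x p = y & {in x :: p, forall z, ~ K z}].

Definition ray_equiv (X : graph) (u v : nat -> X) : Prop :=
  forall K : set X, finite_set K ->
    exists N, forall m n, (N <= m)%N -> (N <= n)%N ->
      connected_off K (u m) (v n).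

Definition ends (X : graph) : set (set (nat -> X)) :=
  [set E | exists2 u : nat -> X, ray u & E = [set v | ray v /\ ray_equiv u v]].
Arguments ends : clear implicits.

Definition one_ended (X : graph) : Prop := exists E, ends X = [set E].

(* Main.v *)
Require Import Defs.
From mathcomp Require Import all_boot all_order all_algebra.
From mathcomp Require Import all_classical all_reals all_analysis.
From mathcomp Require Import zify lra.

(** Let [b] be a horofunction centred at the fixed point [xi]: it drops by one
    along an edge [x], [up x] leading towards [xi], and the group preserves
    differences of [b] up to a constant.  Call [b x] the level of [x], and
    think of [xi] as lying above everything, so that levels decrease upwards.  Hyperbolicity says that vertical
    lines merge: two points of one level at distance at most [n] come within
    a constant of each other after [n] steps up ([iter_close]).  So X looks
    like a tree hanging from [xi], except that a long path of short steps
    inside one level might drift arbitrarily far, as it does in the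
    hyperbolic plane.

    The heart of the proof is that this does not happen when X is locally
    finite ([horopath_bounded]).  Fix a vertex [o], and consider the points at
    depth [n] below [o].  An automorphism carrying one of them to another
    moves [o] by a bounded amount, because it sends lines going up to lines
    going up and these merge around [o].  Automorphisms moving [o] boundedly
    form finitely many cosets of the stabilizer of [o]; hence the stabilizer
    has at most M orbits at depth [n], with M independent of [n].  Take a depth
    at which the number of orbits that are pairwise not close to each other is
    maximal.  Further down, the orbits that lie below distinct ones of these
    are far apart, for a short step between them would merge on the way up.
    A path of short steps therefore stays close to the stabilizer orbit of its
    starting point, in particular it stays below [o].  By transitivity the
    resulting bound holds everywhere.  (In group terms: the boundary minus
    [xi] is a homogeneous space of a totally disconnected group, and its
    orbits under a compact open subgroup are open.)

    Consequently the components of the levels, for paths of short steps,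
    are uniformly bounded, and moving up sufficiently many levels sends
    components into components.  If levels have bounded diameter, X is quasi-isometric
    to a line ([thin_horospheres_line]).  Otherwise there is branching
    somewhere, hence by transitivity everywhere at a uniform scale [k], and the
    components of the levels in [k Z] form a tree in which every vertex has at
    least two and boundedly many children.  Replacing each vertex by a short
    comb ([comb_graph]) makes the tree trivalent without changing its
    quasi-isometry type ([wide_horospheres_tree]).

    Finally, a path from far below to above a vertex [w0] yields, when pushed up
    to the level of [w0], a path of short steps in that level; so it hits a
    fixed ball, which separates a ray going down from a ray going up
    ([not_one_ended]). *)

Set Implicit Arguments.
Unset Strict Implicit.
Unset Printing Implicit Defensive.

Import Order.TTheory GRing.Theory Num.Theory.

(** * The graph metric and balls *)

Section GraphMetric.
Variable X : graph.
Implicit Types x y z : X.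

Lemma dist_walk x y : walk_of_length x y (dist x y).
Proof. by rewrite /dist; case: ex_minnP => n /asboolP. Qed.

Lemma dist_le x y n : walk_of_length x y n -> dist x y <= n.
Proof. by move=> w; rewrite /dist; case: ex_minnP => m _; apply; apply/asboolP. Qed.

Lemma distxx x : dist x x = 0.
Proof. by apply/eqP; rewrite -leqn0; apply: dist_le; exists [::]. Qed.

Lemma dist_eq0 x y : dist x y = 0 -> x = y.
Proof. by have [p [_ + sp]] := dist_walk x y => + d0; case: p sp => //=; lia. Qed.

Lemma dist_sym_le x y : dist x y <= dist y x.
Proof.
have [p [pp lp sp]] := dist_walk y x; rewrite -sp.
apply: dist_le; exists (rev (belast y p)); split.
- rewrite -lp rev_path; apply: sub_path pp => a c /=; by rewrite adj_sym.
- by case: p pp lp sp => //= a p _ _ _; rewrite rev_cons last_rcons.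
- by rewrite size_rev size_belast.
Qed.

Lemma distC x y : dist x y = dist y x.
Proof. by apply/eqP; rewrite eqn_leq !dist_sym_le. Qed.

Lemma dist_triangle y x z : dist x z <= dist x y + dist y z.
Proof.
have [p [pp lp sp]] := dist_walk x y; have [q [pq lq sq]] := dist_walk y z.
apply: dist_le; exists (p ++ q); split.
- by rewrite cat_path pp lp.
- by rewrite last_cat lp.
- by rewrite size_cat sp sq.
Qed.

Lemma dist_adj x y : adj x y -> dist x y = 1.
Proof.
move=> xy; apply/eqP; rewrite eqn_leq; apply/andP; split.
  by apply: dist_le; exists [:: y]; split => //=; rewrite xy.
rewrite lt0n; apply/eqP => /dist_eq0 e; by rewrite e adj_irr in xy.
Qed.

Lemma dist_next x y n : dist x y = n.+1 -> exists2 z, adj x z & dist z y = n.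
Proof.
have [[|z p] [/= + lp sp]] := dist_walk x y => + e; first by lia.
case/andP=> xz pp; exists z => //.
have h : dist z y <= n by apply: dist_le; exists p; split => //; lia.
by have := dist_triangle z x y; rewrite (dist_adj xz); lia.
Qed.

Lemma auto_dist (H : set (X -> X)) f x y :
  automorphism_group H -> H f -> dist (f x) (f y) = dist x y.
Proof.
case=> Ha _ _ Hi.
have le g a c : H g -> dist (g a) (g c) <= dist a c.
  move=> Hg; have [p [pp lp sp]] := dist_walk a c.
  apply: dist_le; exists (map g p); split.
  - rewrite path_map; apply: sub_path pp => u v /=; by rewrite (proj2 (Ha _ Hg)).
  - by rewrite last_map lp.
  - by rewrite size_map.
move=> Hf; apply/eqP; rewrite eqn_leq le //=.
have [g [Hg fK _]] := Hi _ Hf.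
by have := le g (f x) (f y) Hg; rewrite !fK.
Qed.

Lemma finite_ball (lf : locally_finite X) x n :
  exists s : seq X, forall y, dist x y <= n -> y \in s.
Proof.
elim: n x => [|n IH] x.
  by exists [:: x] => y; rewrite leqn0 inE => /eqP/dist_eq0 ->.
have /finite_seqP [t ht] := lf x.
have {}IH : forall z, exists s : seq X, forall y, dist z y <= n -> y \in s by [].
have [S hS] := choice IH.
exists (S x ++ flatten (map S t)) => y; rewrite mem_cat leq_eqVlt => /orP[/eqP e|].
  have [z xz zy] := dist_next e.
  apply/orP; right; apply/flattenP; exists (S z); last by apply: hS; rewrite zy.
  apply: map_f; move: (ht) => /seteqP[h _]; exact: (h z xz).
by rewrite ltnS => /hS ->.
Qed.

(** Transitivity makes the cardinality of balls independent of the centre. *)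
Lemma ball_bound (H : set (X -> X)) (lf : locally_finite X) :
  automorphism_group H -> vertex_transitive H -> X -> forall n, exists M, forall x (t : seq X),
   uniq t -> {in t, forall y, dist x y <= n} -> size t <= M.
Proof.
move=> HG Ht o n; have [s hs] := finite_ball lf o n.
exists (size s) => x t ut tb; have [f Hf fx] := Ht x o.
rewrite -(size_map f); apply: uniq_leq_size.
  have [_ _ _ Hi] := HG; have [g [_ fK _]] := Hi _ Hf.
  by rewrite map_inj_uniq //; exact: can_inj fK.
move=> _ /mapP[y yt ->]; apply: hs.
by rewrite -fx (auto_dist _ _ HG Hf); exact: tb.
Qed.

End GraphMetric.

Lemma pigeonhole_frequently (T : eqType) (s : seq T) (P : T -> nat -> Prop) :
  (forall N, exists n, N <= n /\ exists2 x, x \in s & P x n) ->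
  exists2 x, x \in s & forall N, exists2 n, N <= n & P x n.
Proof.
move=> h; apply: contrapT => no.
have {}no : forall x, exists N, x \in s -> forall n, N <= n -> ~ P x n.
  move=> x; apply: contrapT => nx; apply: no; exists x.
    by apply: contrapT => xs; apply: nx; exists 0.
  move=> N; apply: contrapT => nP; apply: nx; exists N => _ n Nn Px.
  by apply: nP; exists n.
have [F hF] := choice no.
have [n [Nn [x xs Px]]] := h (\max_(x <- s) F x).
by apply: (hF x xs n) => //; apply: leq_trans Nn; exact: leq_bigmax_seq.
Qed.

(** * A horofunction centred at the fixed point at infinity *)

(** The properties of a horofunction [b] centred at a boundary point fixed by
    [H], together with a choice [up] of steps towards that point.
    [horo_triple] is the four-point inequality whose fourth point has gone to
    the boundary point; [horo_auto] says that [H] moves [b] by a constant, up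
    to the error [D]. *)
Record horofunction (X : graph) (H : set (X -> X)) (b : X -> int)
    (up : X -> X) (D : nat) : Prop := Horofunction {
  horo_lip : forall x y, (b x - b y <= (dist x y)%:Z)%R;
  horo_up : forall x, b (up x) = (b x - 1)%R;
  horo_adj : forall x, adj x (up x);
  horo_triple : forall x y p,
    ((dist x y)%:Z + b p <= (dist x p)%:Z + b y + D%:Z)%R \/
    ((dist x y)%:Z + b p <= (dist y p)%:Z + b x + D%:Z)%R;
  horo_auto : forall f, H f -> forall x y,
    (b (f x) - b (f y) <= b x - b y + D%:Z)%R }.

(** The Gromov products of [v] and [w] tend to infinity, written without
    fractions. *)
Definition merging (X : graph) (v w : nat -> X) := forall (o : X) K, exists N,
  forall m n, N <= m -> N <= n -> K + dist (v m) (w n) <= dist (v m) o + dist (w n) o.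

(** For integers the lower limit is attained infinitely often.  This is what
    makes every vertex have a neighbour at which the horofunction is exactly one
    less. *)
Lemma liminf_attained (c : nat -> int) (K : int) :
  (forall n, (- K <= c n <= K)%R) ->
  exists t, (forall N, exists2 n, N <= n & c n = t) /\
            (exists N, forall n, N <= n -> (t <= c n)%R).
Proof.
move=> cK.
have ex : exists j, `[< forall N, exists2 n, N <= n & (c n + K <= j%:Z)%R >].
  exists (absz (K + K)%R); apply/asboolP => N; exists N => //; have := cK N; lia.
case: (ex_minnP ex) => j /asboolP hj jmin.
have [N hN] : exists N, forall n, N <= n -> (j%:Z <= c n + K)%R.
  apply: contrapT => no; have j0 : 0 < j.
    rewrite lt0n; apply/eqP => j0; apply: no; exists 0 => n _; have := cK n; lia.
  suff /jmin : `[< forall N, exists2 n, N <= n & (c n + K <= j.-1%:Z)%R >] by lia.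
  apply/asboolP => N; apply: contrapT => no'; apply: no; exists N => n Nn.
  by apply: contrapT => lt; apply: no'; exists n => //; lia.
exists (j%:Z - K)%R; split; last by exists N => n /hN; lia.
move=> N'; have [n] := hj (maxn N N'); rewrite geq_max => /andP[Nn N'n] h.
by exists n => //; have := hN n Nn; lia.
Qed.

Section FromBoundary.
Variables (R : realType) (X : graph).
Implicit Types (x y z : X) (u v : nat -> X).

Lemma hyperbolic_four_point : hyperbolic R X -> exists D, forall x y z w : X,
  dist x z + dist y w <= dist x y + dist z w + D \/
  dist x z + dist y w <= dist y z + dist x w + D.
Proof.
case=> delta hd; exists (Num.truncn (`|2 * delta|%R)).+1 => x y z w.
set D := _.+1.
have hD : (2 * delta <= D%:R :> R)%R.
  apply: le_trans (ler_norm _) _; apply: ltW; exact: truncnS_gt.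
have [h|h] : ((dist x z + dist y w)%:R <= (dist x y + dist z w + D)%:R :> R)%R \/
  ((dist x z + dist y w)%:R <= (dist y z + dist x w + D)%:R :> R)%R.
- have := hd w x y z; rewrite /gromov_product minEle !natrD.
  by case: ifP => _ h; [left|right]; lra.
- by left; rewrite ler_nat in h.
- by right; rewrite ler_nat in h.
Qed.

Lemma gromov_equiv_merging u v : gromov_equiv R u v -> merging u v.
Proof.
move=> uv o K; have /cvgryPge/(_ K%:R%R) := uv o.
case=> -[Q1 Q2] /= [[N1 _ h1] [N2 _ h2]] h.
exists (maxn N1 N2) => m n; rewrite !geq_max => /andP[m1 m2] /andP[n1 n2].
have /= := h (m, n) (conj (h1 _ m1) (h2 _ n2)).
rewrite /gromov_product -(ler_nat R) !natrD => g.
have K0 : (0 <= K%:R :> R)%R by [].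
lra.
Qed.

End FromBoundary.

Section Busemann.
Variables (X : graph) (H : set (X -> X)) (D : nat) (u : nat -> X).
Hypothesis four_point : forall x y z w : X,
  dist x z + dist y w <= dist x y + dist z w + D \/
  dist x z + dist y w <= dist y z + dist x w + D.
Hypothesis lf : locally_finite X.
Hypothesis HG : automorphism_group H.
Hypothesis uu : merging u u.
Hypothesis ufu : forall f, H f -> merging u (f \o u).

(** When the Gromov product of [v] and [w] is large, [x, y] and [v, w] cannot
    be the dominant pairing in the four-point inequality. *)
Lemma four_point_far (x y v w : X) :
  2 * dist x y + D + dist v w < dist v x + dist w x ->
  (`|((dist x v)%:Z - (dist y v)%:Z) - ((dist x w)%:Z - (dist y w)%:Z)| <= D%:Z)%R.
Proof.
move=> far; have := dist_triangle y x v; have := dist_triangle x y v.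
have := dist_triangle y x w; have := dist_triangle x y w.
have := four_point x y v w; have := four_point x y w v.
rewrite (distC y x) !(distC v x) !(distC w x) !(distC w v) in far *.
lia.
Qed.

(** The function is the lower limit of [dist x (u n) - dist o (u n)].  These
    differences are eventually constant up to [D] by [four_point_far], so
    each inequality passes to the limit with an error of a few [D]; and since
    neighbours are finitely many, one of them is infinitely often the next
    vertex on a geodesic towards [u n]. *)
Lemma horofunction_exists : X -> exists b up, horofunction H b up (3 * D).
Proof.
move=> o.
pose a n x := ((dist x (u n))%:Z - (dist o (u n))%:Z)%R.
have /choice [b hb] : forall x, exists t,
    (forall N, exists2 n, N <= n & a n x = t) /\
    (exists N, forall n, N <= n -> (t <= a n x)%R).
  move=> x; apply: (@liminf_attained (a^~ x) (dist x o)%:Z) => n; rewrite /a.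
  by have := dist_triangle o x (u n); have := dist_triangle x o (u n);
    rewrite (distC o x); lia.
have near_b x : exists N, forall n, N <= n -> (b x <= a n x <= b x + D%:Z)%R.
  have [freq [N1 lowb]] := hb x.
  have [N2 h2] := uu x (2 * dist x o + D).+1.
  exists (maxn N1 N2) => n; rewrite geq_max => /andP[n1 n2].
  rewrite lowb // andTb; have [m] := freq (maxn N1 N2).
  rewrite geq_max => /andP[m1 m2] <-.
  have := @four_point_far x o (u n) (u m).
  by have := h2 n m n2 m2; rewrite /a; lia.
have lip x y : (b x - b y <= (dist x y)%:Z)%R.
  have [N hN] := near_b x; have [n Nn <-] := (hb y).1 N.
  by have := hN n Nn; rewrite /a; have := dist_triangle y x (u n); lia.
have step x : exists y, adj x y /\ b y = (b x - 1)%R.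
  have /finite_seqP [s hs] := lf x.
  have [N1 escape] := uu x 1.
  have [|y ys hy] := @pigeonhole_frequently X s
      (fun y n => a n y = (b x - 1)%R /\ adj x y).
    move=> N; have [n] := (hb x).1 (maxn N N1).
    rewrite geq_max => /andP[Nn n1] abn; exists n; split => //.
    have := escape n n n1 n1; rewrite distxx (distC _ x) => un.
    have [|y xy yn] := @dist_next _ x (u n) (dist x (u n)).-1; first by lia.
    exists y; first by move/seteqP: hs => [h _]; exact: (h y xy).
    by split => //; move: abn; rewrite /a yn; lia.
  have [n _ [_ xy]] := hy 0; exists y; split => //.
  have [N hN] := near_b y; have [m Nm [am _]] := hy N.
  by have := hN m Nm; have := lip x y; rewrite (dist_adj xy); lia.
have [up hup] := choice step.
exists b, up; split.
- exact: lip.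
- by move=> x; case: (hup x).
- by move=> x; case: (hup x).
- move=> x y p; have [N1 h1] := near_b x; have [N2 h2] := near_b y.
  have [N3 h3] := near_b p; pose n := N1 + N2 + N3.
  have := h1 n _; have := h2 n _; have := h3 n _.
  move=> /(_ ltac:(rewrite /n; lia)) + /(_ ltac:(rewrite /n; lia)) +
    /(_ ltac:(rewrite /n; lia)); rewrite /a.
  have := four_point x p y (u n).
  rewrite (distC p y); lia.
- move=> f Hf x y.
  have [N1 h1] := near_b x; have [N2 h2] := near_b y.
  have [N3 h3] := near_b (f x); have [N4 h4] := near_b (f y).
  have [N5 h5] := ufu Hf (f x) (2 * dist (f x) (f y) + D).+1.
  pose n := N1 + N2 + N3 + N4 + N5.
  have := h1 n ltac:(rewrite /n; lia); have := h2 n ltac:(rewrite /n; lia).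
  have := h3 n ltac:(rewrite /n; lia); have := h4 n ltac:(rewrite /n; lia).
  have := h5 n n ltac:(rewrite /n; lia) ltac:(rewrite /n; lia).
  have := @four_point_far (f x) (f y) (u n) (f (u n)).
  by rewrite /a /= !(auto_dist _ _ HG Hf); lia.
Qed.
End Busemann.

(** For [f] fixing the boundary point, [u] and [f \o u] represent the same
    point, so [b] and [b \o f] differ by a constant up to a bounded error. *)
Lemma focal_horofunction (R : realType) (X : graph) (H : set (X -> X)) xi :
  locally_finite X -> hyperbolic R X -> automorphism_group H ->
  boundary R X xi -> fixes_at_infinity H xi ->
  exists b up D, horofunction H b up D.
Proof.
move=> lf /hyperbolic_four_point[D fp] HG [u uu xiE] fix_xi.
have [b [up h]] : exists b up, horofunction H b up (3 * D).
  apply: (@horofunction_exists X H D u) => //; last exact: (u 0).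
    exact: gromov_equiv_merging uu.
  move=> f Hf; apply: (@gromov_equiv_merging R).
  have : xi (f \o u) by rewrite -(fix_xi f Hf); exists u => //; rewrite xiE.
  by rewrite xiE => -[].
by exists b, up, (3 * D).
Qed.

(** * Horospherical paths are bounded *)

Section Horospheres.
Variables (X : graph) (H : set (X -> X)) (b : X -> int) (up : X -> X) (D : nat).
Hypotheses (lf : locally_finite X) (HG : automorphism_group H).
Hypotheses (Ht : vertex_transitive H) (hF : horofunction H b up D).
Implicit Types (x y z p q : X) (f u : X -> X).

Let triple x y p := horo_triple hF x y p.
Let dist_auto f x y := @auto_dist X H f x y HG.

Lemma b_iter n x : b (iter n up x) = (b x - n%:Z)%R.
Proof. by elim: n => [|n IH] /=; rewrite ?(horo_up hF) ?IH; lia. Qed.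

Lemma dist_iter n x : dist x (iter n up x) = n.
Proof.
have := horo_lip hF x (iter n up x); rewrite b_iter => ge.
suff : dist x (iter n up x) <= n by lia.
elim: n {ge} => [|n IH]; first by rewrite distxx.
apply: leq_trans (dist_triangle (iter n up x) _ _) _.
by rewrite iterS (dist_adj (horo_adj hF _)); lia.
Qed.

Lemma b_auto f x y : H f -> (`|b (f x) - b (f y) - (b x - b y)| <= D%:Z)%R.
Proof. by move=> Hf; have := horo_auto hF Hf x y; have := horo_auto hF Hf y x; lia. Qed.

(** The point [p] is, up to [C], on a geodesic ray from [x] to the boundary
    point: going from [x] to [p] costs hardly more than the drop of level. *)
Definition above C p x := ((dist p x)%:Z <= b x - b p + C%:Z)%R.

Lemma above_iter n x : above 0 (iter n up x) x.
Proof. by rewrite /above distC dist_iter b_iter; lia. Qed.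

(** Rays from a common point to the boundary point stay together. *)
Lemma above_merge C p q x : above C p x -> above C q x ->
  ((dist p q)%:Z <= `|b p - b q| + C%:Z + D%:Z)%R.
Proof. by rewrite /above => hp hq; have := triple p q x; lia. Qed.

(** A point high enough above [x] is also above all points near [x]: vertical
    lines merge. *)
Lemma above_push C p x y : above C p x -> ((dist x y)%:Z <= b x - b p)%R ->
  above (C + D) p y.
Proof.
rewrite /above => hp xy; have := horo_lip hF x y; have := triple p y x.
by rewrite (distC y x); lia.
Qed.

Lemma above_auto C f p x : H f -> above C p x -> above (C + D) (f p) (f x).
Proof. by rewrite /above => Hf; rewrite dist_auto //; have := b_auto x p Hf; lia. Qed.

Lemma aboveW C C' p x : C <= C' -> above C p x -> above C' p x.
Proof. rewrite /above; lia. Qed.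

(** Every vertex has points approximately below it at every depth, since some
    vertex has and the group is transitive. *)
Lemma descendant x m : exists2 z, above D x z & (`|b z - b x - m%:Z| <= D%:Z)%R.
Proof.
have [f Hf fx] := Ht (iter m up x) x; exists (f x).
  by rewrite -{1}fx; apply: (above_auto (C:=0)) => //; exact: above_iter.
by have := b_auto x (iter m up x) Hf; rewrite b_iter fx; lia.
Qed.

(** Exact descendants at every depth need not exist below a given vertex;
    the vertices that have them are used to extend configurations downwards
    without accumulating errors. *)
Definition good x := forall n, exists z, iter n up z = x.

(** Approximate descendants at depth [N] have exact ancestors close to [x], and
    by local finiteness one vertex close to [x] serves for infinitely many
    [N]. *)
Lemma good_near x t : exists q,
  [/\ good q, b q = t & ((dist q x)%:Z <= `|t - b x| + (2 * D)%:Z)%R].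
Proof.
have [s hs] := finite_ball lf x (absz (`|t - b x| + (2 * D)%:Z)%R).
have [|q qs hq] := @pigeonhole_frequently X s
  (fun q n => [/\ exists z, iter n up z = q, b q = t &
              ((dist q x)%:Z <= `|t - b x| + (2 * D)%:Z)%R]).
  move=> N; have [z xz bz] := descendant x (N + absz (t - b x)%R + D).
  pose n := absz (b z - t)%R.
  exists n; split; first by rewrite /n; lia.
  have bq : b (iter n up z) = t by rewrite b_iter /n; lia.
  have dq : ((dist (iter n up z) x)%:Z <= `|t - b x| + (2 * D)%:Z)%R.
    rewrite -bq; have := above_merge (aboveW (leq0n D) (above_iter n z)) xz.
    lia.
  exists (iter n up z); last by split => //; exists z.
  by apply: hs; rewrite distC; lia.
have [_ _ [_ bq dq]] := hq 0; exists q; split => // n.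
have [m nm [[z hz] _ _]] := hq n.
by exists (iter (m - n) up z); rewrite -iterD subnKC.
Qed.

Lemma good_pred x : good x -> exists2 y, up y = x & good y.
Proof.
move=> gx; have /finite_seqP [s hs] := lf x.
have [|y ys hy] := @pigeonhole_frequently X s
  (fun y n => up y = x /\ exists z, iter n up z = y).
  move=> N; have [z hz] := gx N.+1; exists N; split => //.
  exists (iter N up z); last by split => //; exists z.
  move/seteqP: hs => [h _]; apply: (h (iter N up z)) => /=.
  by rewrite -hz adj_sym; exact: horo_adj hF _.
have [_ _ [yx _]] := hy 0; exists y => // n.
have [m nm [_ [z hz]]] := hy n.
by exists (iter (m - n) up z); rewrite -iterD subnKC.
Qed.

Lemma good_desc m x : good x -> exists2 y, iter m up y = x & good y.
Proof.
move=> gx; elim: m => [|m [y yx gy]]; first by exists x.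
by have [z zy gz] := good_pred gy; exists z => //; rewrite iterSr zy.
Qed.

Section Shadow.
Variable o : X.

Definition stab_near s x y := exists u, [/\ H u, u o = o & dist (u x) y <= s].

Lemma stab_near_sym s x y : stab_near s x y -> stab_near s y x.
Proof.
case=> u [Hu uo d]; have [_ _ _ Hi] := HG; have [g [Hg uK gK]] := Hi _ Hu.
exists g; split => //; first by rewrite -uo uK.
by rewrite -(dist_auto _ _ Hu) gK distC.
Qed.

Lemma stab_near_trans s t y x z :
  stab_near s x y -> stab_near t y z -> stab_near (s + t) x z.
Proof.
case=> u [Hu uo d] [v [Hv vo d']]; have [_ _ Hc _] := HG.
exists (v \o u); split => /=; [exact: Hc|by rewrite uo|].
apply: leq_trans (dist_triangle (v y) _ _) _.
by rewrite dist_auto //; lia.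
Qed.

Lemma stab_near_dist s x y : dist x y <= s -> stab_near s x y.
Proof. by move=> d; have [_ Hid _ _] := HG; exists id. Qed.

(** Orbits of the stabilizer at any distance [t] from each other have merged,
    up to a uniform constant, [t] levels higher. *)
Lemma stab_near_up t m x y : b x = b y -> t <= m -> stab_near t x y ->
  stab_near (3 * D) (iter m up x) (iter m up y).
Proof.
move=> bxy tm [u [Hu uo d]]; exists u; split => //.
have := b_auto x o Hu; have := b_auto (iter m up x) o Hu.
have := b_auto (iter m up x) x Hu; rewrite uo !b_iter => h1 h2 h3.
have dux : dist (u (iter m up x)) (u x) = m by rewrite dist_auto // distC dist_iter.
have := triple (u (iter m up x)) y (u x); rewrite dux (distC y) => t1.
have := triple (u (iter m up x)) (iter m up y) y.
by rewrite (distC (iter m up y)) dist_iter !b_iter; lia.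
Qed.

Definition shadow n C x := [/\ good x, b x = (b o + n%:Z)%R & dist o x <= n + C].

Definition separated := pairwise (fun x y => ~~ `[< stab_near (3 * D) x y >]).

(** The stabilizer of [o] has boundedly many orbits at depth [n], uniformly in
    [n].  If [f] carries [x] to [y] then the inverse of [f] moves [o] by at
    most [C + 2 * D], as [o] and its image are both above a common point; and
    if the inverses of two such [f] agree at [o], their targets are in one
    orbit of the stabilizer. *)
Lemma separated_bound C : exists M, forall n (t : seq X),
  {in t, forall y, shadow n C y} -> separated t -> size t <= M.
Proof.
have [M hM] := ball_bound lf HG Ht o (C + 2 * D).
exists M => n [|x t] ht sep //.
have /choice [F hinv] : forall y, exists fg : (X -> X) * (X -> X),
    [/\ H fg.1, fg.1 x = y, cancel fg.1 fg.2 & cancel fg.2 fg.1].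
  move=> y; have [f Hf fx] := Ht x y; have [_ _ _ Hi] := HG.
  by have [g [Hg fK gK]] := Hi _ Hf; exists (f, g).
rewrite -(size_map (fun y => (F y).2 o)); apply: (hM o).
  rewrite uniq_pairwise pairwise_map.
  apply: (sub_in_pairwise (P := mem (x :: t)) _ _ sep); last by apply/allP.
  move=> y z yt zt /= /asboolP; apply: contra_not_neq => e.
  have [H1 e1 K1 K1'] := hinv y; have [H2 e2 K2 K2'] := hinv z.
  have [_ _ Hc Hi] := HG; exists ((F z).1 \o (F y).2); split.
  - apply: Hc => //; have [g [Hg gK _]] := Hi _ H1.
    suff -> : (F y).2 = g by [].
    by apply/funext => w; rewrite -{2}(K1' w) gK.
  - by rewrite /= e K2'.
  - have -> : ((F z).1 \o (F y).2) y = z by rewrite /= -{2}e1 K1 e2.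
    by rewrite distxx.
move=> _ /mapP[y yt ->]; have [H1 e1 K1 K1'] := hinv y.
have [_ bx dx] := ht x (mem_head _ _); have [_ bY dy] := ht y yt.
rewrite -(dist_auto _ _ H1) K1'.
have dFo : dist ((F y).1 o) y = dist o x by rewrite -[RHS](dist_auto _ _ H1) e1.
have := triple ((F y).1 o) o y; have := b_auto o x H1.
by rewrite e1 dFo; lia.
Qed.

(** A maximal family [ys] of separated points is moved down by [m] levels to a
    family [map g ys], which by maximality meets the orbit neighbourhood of
    every point at the new depth.  A step of length [r] between neighbourhoods
    of two distinct members would, seen [m] levels higher, contradict the
    separation of [ys].  So the whole path is close to the orbit of its first
    point, and being below [o] is a property of the orbit. *)
Lemma shadow_rigid r C0 : exists n, forall x s,
  shadow n C0 x -> {in s, forall y, good y /\ b y = (b o + n%:Z)%R} ->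
  path (fun y z => dist y z <= r) x s -> {in s, forall y, dist o y <= n + C0 + 2 * D}.
Proof.
(* The points of the path are shown to be within [C0 + 2 * D] of lying below
   [o]; the extra [D] pays for the next step, before it is known to stay in the
   orbit. *)
pose C := C0 + 3 * D; have [M hM] := separated_bound C.
pose P k := `[< exists n (t : seq X),
   [/\ {in t, forall y, shadow n C y}, separated t & size t = k] >].
have exP : exists k, P k by exists 0; apply/asboolP; exists 0, [::].
have leP k : P k -> k <= M by move=> /asboolP[n [t [h1 h2 <-]]]; exact: hM h1 h2.
case: (ex_maxnP exP leP) => k /asboolP[n0 [ys [ysS sep ysk]]] kmax {exP leP M hM}.
(* Two separations of [3 * D] and one step of length [r] must merge on the way
   up. *)
pose m := 6 * D + r; pose n := n0 + m; exists n.
have /choice [g hg] : forall y, exists z, good y -> iter m up z = y /\ good z.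
  move=> y; have [/(good_desc m)[z zy gz]|] := EM (good y); first by exists z.
  by exists y.
have gS y : y \in ys -> shadow n C (g y).
  move=> /ysS[gy bY dy]; have [e gg] := hg y gy; split => //.
    by move: (b_iter m (g y)); rewrite e /n; lia.
  have dyg : dist y (g y) = m by rewrite -{1}e distC dist_iter.
  by have := dist_triangle y o (g y); rewrite dyg /n; lia.
have lift t y z : y \in ys -> z \in ys -> t <= m ->
    stab_near t (g y) (g z) -> stab_near (3 * D) y z.
  move=> yy zz tm h; have [gy _ _] := ysS y yy; have [gz _ _] := ysS z zz.
  rewrite -(hg y gy).1 -(hg z gz).1; apply: stab_near_up tm h.
  by have [_ -> _] := gS y yy; have [_ -> _] := gS z zz.
have uniq_class y z : y \in ys -> z \in ys -> stab_near (3 * D) y z -> y = z.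
  move=> yy zz h; move/(pairwiseP y): sep => sep.
  have iy : index y ys < size ys by rewrite index_mem.
  have iz : index z ys < size ys by rewrite index_mem.
  case: (ltngtP (index y ys) (index z ys)) => e.
  - by have := sep _ _ iy iz e; rewrite !nth_index // => /asboolP.
  - by have := sep _ _ iz iy e; rewrite !nth_index // => /asboolP[]; exact: stab_near_sym.
  - by rewrite -(nth_index y yy) e nth_index.
have cover x : shadow n C x -> exists2 y, y \in ys & stab_near (3 * D) x (g y).
  move=> xS; apply: contrapT => no.
  suff /kmax : P k.+1 by rewrite ltnn.
  apply/asboolP; exists n, (x :: map g ys); split; last by rewrite /= size_map ysk.
    by move=> y; rewrite inE => /predU1P[->|/mapP[z zz ->]] //; exact: gS.
  rewrite /separated /=; apply/andP; split.
    apply/allP => _ /mapP[y yy ->]; apply/asboolP => h; apply: no; by exists y.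
  rewrite pairwise_map; apply: (sub_in_pairwise (P := mem ys) _ _ sep); last exact/allP.
  move=> y z yy zz /= /asboolP nyz; apply/asboolP => h; apply: nyz.
  by apply: lift h => //; rewrite /m; lia.
move=> x s xS; have [_ bx dx] := xS.
have [y0 yy0 xy0] : exists2 y, y \in ys & stab_near (3 * D) x (g y).
  by apply: cover; case: xS => *; split => //; rewrite /C; lia.
have class_dist z : b z = (b o + n%:Z)%R -> stab_near (3 * D) z (g y0) ->
    dist o z <= n + C0 + 2 * D.
  move=> bz zy; have [u [Hu uo d]] := stab_near_trans xy0 (stab_near_sym zy).
  have := triple o z (u x); have := b_auto x o Hu; rewrite uo (distC z).
  have -> : dist o (u x) = dist o x by rewrite -{1}uo dist_auto.
  by rewrite /n /m in bx bz dx *; lia.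
move=> sS; suff : forall x', b x' = (b o + n%:Z)%R -> stab_near (3 * D) x' (g y0) ->
    path (fun y z => dist y z <= r) x' s -> {in s, forall y, dist o y <= n + C0 + 2 * D}.
  by apply.
elim: s sS => // z s IH sS x' bx' xy' /= /andP[xz pz].
have [gz bz] := sS z (mem_head _ _).
have dx' := class_dist _ bx' xy'.
have zS : shadow n C z.
  split => //; have := triple o z x'; rewrite (distC z) /C.
  rewrite /n /m in bz bx' dx' *; lia.
have [y1 yy1 zy1] := cover z zS.
have y01 : y0 = y1.
  apply: uniq_class => //; apply: (lift (3 * D + (r + 3 * D))) => //; first by rewrite /m; lia.
  apply: stab_near_trans (stab_near_sym xy') _.
  exact: stab_near_trans (stab_near_dist xz) zy1.
rewrite -y01 in zy1.
move=> y; rewrite inE => /predU1P[->|]; first exact: class_dist.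
apply: (IH _ z) => // w ws; apply: sS; by rewrite inE ws orbT.
Qed.

End Shadow.

(** The steps of paths in a horosphere: bounded jumps at constant level. *)
Definition horostep r : rel X := fun x y => (dist x y <= r) && (b x == b y).

Lemma horopath_level r x s : path (horostep r) x s -> {in s, forall y, b y = b x}.
Proof.
elim: s x => // z s IH x /= /andP[/andP[_ /eqP e] /IH h] y.
by rewrite inE => /predU1P[-> //|/h ->].
Qed.

(** The given path is moved under [o] by an automorphism, which perturbs levels by
    at most [D]; each of its points is then replaced by a good point at the
    exact level, at distance at most [3 * D], so that [shadow_rigid] applies
    to steps of length [r + 6 * D]. *)
Lemma horopath_bounded r : exists B, forall x s,
  path (horostep r) x s -> {in s, forall y, dist x y <= B}.
Proof.
case: (pselect (exists x : X, True)) => [[ o _]|noX]; last first.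
  by exists 0 => x; case: noX; exists x.
have [n hn] := shadow_rigid o (r + 6 * D) (3 * D).
exists (2 * n + 8 * D) => x s ps.
have [f Hf fx] := Ht (iter n up x) o.
have /choice [g hg] : forall y, exists q, b y = b x ->
    [/\ good q, b q = (b o + n%:Z)%R & dist (f y) q <= 3 * D].
  move=> y; have [q [gq bq dq]] := good_near (f y) (b o + n%:Z)%R.
  exists q => byx; split => //.
  by have := b_auto y (iter n up x) Hf; rewrite fx b_iter distC; lia.
have lev := horopath_level ps.
have dfx : dist o (f x) = n by rewrite -fx dist_auto // distC dist_iter.
have [gx bx dx] := hg x erefl.
have xS : shadow o n (3 * D) (g x).
  by split => //; have := dist_triangle (f x) o (g x); lia.
have := hn (g x) (map g s) xS.
move=> h y ys.
have /h {h} : {in map g s, forall y, good y /\ b y = (b o + n%:Z)%R}.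
  by move=> _ /mapP[z zs ->]; have [] := hg z (lev z zs).
rewrite path_map => h.
have {h} : {in map g s, forall y, dist o y <= n + 3 * D + 2 * D}.
  apply: h; apply: (sub_in_path (P := [pred z | b z == b x]) _ _ ps); last first.
    by rewrite /= eqxx; apply/allP => z zs; rewrite inE (lev z zs).
  move=> z w /eqP zx /eqP wx /andP[zw _] /=.
  have [_ _ dz] := hg z zx; have [_ _ dw] := hg w wx.
  have := dist_triangle (f z) (g z) (g w); have := dist_triangle (f w) (f z) (g w).
  by rewrite (distC (g z) (f z)) dist_auto //; lia.
move=> /(_ (g y) (map_f _ ys)) dgy; have [_ _ dy] := hg y (lev y ys).
have := dist_triangle o (f x) (f y); have := dist_triangle (g y) o (f y).
by rewrite (distC (f x) o) (distC (g y) (f y)) dist_auto //; lia.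
Qed.

End Horospheres.

(** * Rays and ends *)

Section Ends.
Variable X : graph.

Lemma connected_off_sym (K : set X) x y : connected_off K x y -> connected_off K y x.
Proof.
case=> p [pp lp pK]; exists (rev (belast x p)); split.
- rewrite -lp rev_path; apply: sub_path pp => a c /=; by rewrite adj_sym.
- by case: p pp lp pK => //= a p _ _ _; rewrite rev_cons last_rcons.
- move=> z; rewrite inE mem_rev => h; apply: pK; move: h.
  by rewrite -lp => /predU1P[->|/mem_belast]; rewrite ?mem_last.
Qed.

Lemma ray_eventually_off (u : nat -> X) (K : set X) : ray u -> finite_set K ->
  exists N, forall n, N <= n -> ~ K (u n).
Proof.
move=> [uI _] /finite_seqP[s ->].
apply: contrapT => no; have [|x xs hx] := @pigeonhole_frequently X s (fun x n => u n = x).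
  move=> N; apply: contrapT => h; apply: no; exists N => n Nn us.
  by apply: h; exists n; split => //; exists (u n).
have [n _ e] := hx 0; have [m nm e'] := hx n.+1.
by have := uI n m; rewrite e e' => /(_ erefl); lia.
Qed.

Lemma ray_equiv_refl (u : nat -> X) : ray u -> ray_equiv u u.
Proof.
move=> ru K fK; have [N hN] := ray_eventually_off ru fK; exists N.
have le m k : N <= m -> connected_off K (u m) (u (m + k)).
  move=> Nm; elim: k => [|k [p [pp lp pK]]].
    by exists [::]; split; rewrite ?addn0 // => z; rewrite inE => /eqP ->; exact: hN.
  exists (rcons p (u (m + k.+1))); split.
  - by rewrite rcons_path pp lp addnS; case: ru => _ ->.
  - by rewrite last_rcons.
  - move=> z; rewrite -rcons_cons mem_rcons inE => /predU1P[->|/pK //].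
    by apply: hN; lia.
move=> m n Nm Nn; have [mn|/ltnW nm] := leqP m n.
  by rewrite -(subnKC mn); exact: le.
by apply: connected_off_sym; rewrite -(subnKC nm); exact: le.
Qed.

Lemma one_ended_ray_equiv (u v : nat -> X) : one_ended X -> ray u -> ray v -> ray_equiv u v.
Proof.
case=> E hE ru rv.
have cl w : ray w -> E = [set w' | ray w' /\ ray_equiv w w']%classic.
  move=> rw; suff : ends X [set w' | ray w' /\ ray_equiv w w']%classic by rewrite hE => ->.
  by exists w.
have : E v by rewrite (cl v rv); split => //; exact: ray_equiv_refl.
by rewrite (cl u ru) => -[].
Qed.

End Ends.

(** * Pushing up to a level; the two ends of a vertical line *)

Section VerticalLines.
Variables (X : graph) (H : set (X -> X)) (b : X -> int) (up : X -> X) (D : nat).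
Hypotheses (lf : locally_finite X) (HG : automorphism_group H).
Hypotheses (Ht : vertex_transitive H) (hF : horofunction H b up D).
Implicit Types (x y z p q : X) (f u : X -> X).

Let biter := b_iter hF.

(** Vertical lines starting at distance at most [m] have merged after [m]
    steps. *)
Lemma iter_close m n x y : b (iter m up x) = b (iter n up y) -> dist x y <= m ->
  dist (iter m up x) (iter n up y) <= 2 * D.
Proof.
move=> e xy; have h1 := above_iter hF m x; have h2 := above_iter hF n y.
have h3 : above b D (iter m up x) y.
  by apply: (above_push hF (C := 0) h1); rewrite biter; lia.
by have := above_merge hF h3 (aboveW (leq0n D) h2); lia.
Qed.

(** The ancestor of [x] at level [t], meaningful when [t <= b x]. *)
Definition lift_to t x := iter (absz (b x - t)%R) up x.

Lemma lift_step t x y : adj x y -> (t <= b x)%R -> (t <= b y)%R ->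
  horostep b (2 * D + 1) (lift_to t x) (lift_to t y).
Proof.
move=> xy tx ty; have e : b (lift_to t x) = b (lift_to t y) by rewrite /lift_to !biter; lia.
rewrite /horostep e eqxx andbT.
have [x0|x0] := eqVneq (b x) t; last first.
  have := iter_close e; rewrite (dist_adj xy) /lift_to; lia.
have [y0|y0] := eqVneq (b y) t; last first.
  by have := iter_close (esym e); rewrite distC (dist_adj xy) distC /lift_to; lia.
by rewrite /lift_to x0 y0 subrr /= (dist_adj xy); lia.
Qed.

(** Until it first reaches a level smaller than [t], the path can be pushed up
    to level [t], where it becomes a path in the horosphere; it meets that path
    at the crossing [z]. *)
Lemma path_down_to t x s : path (@adj X) x s -> (t <= b x)%R -> (b (last x s) < t)%R ->
  exists s' z, [/\ z \in x :: s, path (horostep b (2 * D + 1)) (lift_to t x) s' &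
                last (lift_to t x) s' = z].
Proof.
elim: s x => [|y s IH] x /=; first by move=> _; lia.
case/andP=> xy ps tx lt; have [ty|yt] := lerP t (b y).
  have [s' [z [zs ps' ls']]] := IH y ps ty lt.
  exists (lift_to t y :: s'), z; split => //=; first by rewrite inE zs orbT.
  by rewrite lift_step.
exists [::], x; split => //=; first exact: mem_head.
have := horo_lip hF x y; rewrite (dist_adj xy) => h.
by rewrite /lift_to (_ : b x = t) ?subrr //; lia.
Qed.

(** A ray going down from a good vertex [w0] and the one going up from [w0]
    are separated by a ball around [w0]. *)
Lemma not_one_ended (o : X) : ~ one_ended X.
Proof.
have [B hB] := horopath_bounded lf HG Ht hF (2 * D + 1).
have [w0 [gw0 _ _]] := good_near lf HG Ht hF o 0%R.
have /choice [G hG] : forall x, exists y, good up x -> up y = x /\ good up y.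
  move=> x; have [/(good_pred lf hF)[y yx gy]|] := EM (good up x); first by exists y.
  by exists x.
pose u n := iter n up w0; pose w n := iter n G w0.
have gw n : good up (w n) by elim: n => // n IH; exact: (hG _ IH).2.
have wK n : iter n up (w n) = w0.
  by elim: n => // n IH; rewrite iterSr /= (hG _ (gw n)).1.
have bw n : b (w n) = (b w0 + n%:Z)%R by have := biter n (w n); rewrite wK; lia.
have ru : ray u.
  split; last by move=> n; exact: horo_adj hF _.
  by move=> m n e; have := biter m w0; have := biter n w0; rewrite -/(u m) -/(u n) e; lia.
have rw : ray w.
  split; first by move=> m n e; have := bw m; rewrite e bw; lia.
  by move=> n; rewrite adj_sym -(hG _ (gw n)).1; exact: horo_adj hF _.
move=> oe; have [s hs] := finite_ball lf w0 B.
pose K := [set x | dist w0 x <= B]%classic.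
have fK : finite_set K by apply: sub_finite_set (finite_seq s) => x /hs.
have [N hN] := one_ended_ray_equiv oe rw ru fK.
have [p [pp lp pK]] := hN N N.+1 (leqnn N) (leqnSn N).
have [|| s' [z [zp ps' ls']]] := path_down_to (t := b w0) pp.
- by rewrite bw; lia.
- by rewrite lp biter; lia.
have e : lift_to (b w0) (w N) = w0.
  by rewrite /lift_to bw (_ : absz _ = N) //; lia.
rewrite e in ps' ls'; apply: (pK z zp); rewrite /K /= -ls'.
have := mem_last w0 s'; rewrite inE => /predU1P[->|/(hB _ _ ps') //].
by rewrite distxx.
Qed.

End VerticalLines.

(** * Quasi-isometries and trees given by a parent function *)

Section QuasiIsometry.
Variables (R : realType) (X Y : graph).

Lemma edge_lipschitz (Z W : graph) (f : Z -> W) N :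
  (forall x y, adj x y -> dist (f x) (f y) <= N) ->
  forall x y, dist (f x) (f y) <= N * dist x y.
Proof.
move=> fN x y; move e : (dist x y) => n; elim: n x e => [|n IH] x e.
  by rewrite (dist_eq0 e) distxx.
have [z xz zy] := dist_next e.
apply: leq_trans (dist_triangle (f z) _ _) _.
by have := fN _ _ xz; have := IH z zy; rewrite mulnS; lia.
Qed.

(** Between graphs it is enough to control edges. *)
Lemma quasi_isometric_of_inverse (f : X -> Y) (g : Y -> X) N :
  (forall x y, adj x y -> dist (f x) (f y) <= N) ->
  (forall v w, adj v w -> dist (g v) (g w) <= N) ->
  (forall x, dist (g (f x)) x <= N) -> (forall v, dist (f (g v)) v <= N) ->
  quasi_isometric R X Y.
Proof.
move=> /edge_lipschitz fN /edge_lipschitz gN gf fg.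
exists f, (N.+1%:R)%R, (2 * N).+1%:R%R; split.
- by rewrite ler1n.
- by rewrite ler0n.
- move=> x y; apply/andP; split.
    rewrite lerBlDr mulrC ler_pdivrMr ?ltr0n // -natrD -natrM ler_nat.
    have := dist_triangle (g (f x)) x y; have := dist_triangle (g (f y)) (g (f x)) y.
    by have := gN (f x) (f y); have := gf x; have := gf y; rewrite (distC x (g (f x))); nia.
  by rewrite -natrM -natrD ler_nat; have := fN x y; nia.
- by move=> y; exists (g y); rewrite ler_nat distC; have := fg y; lia.
Qed.

End QuasiIsometry.

(** A parent function that strictly lowers a height and whose iterates make any
    two vertices meet defines a tree.  There is no root: the heights are
    integers, and the tree hangs from a point at infinity. *)
Section ParentGraph.
Variables (V : eqType) (par : V -> V) (ht : V -> int).
Hypothesis ht_par : forall v, (ht (par v) < ht v)%R.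
Hypothesis par_meet : forall v w, exists m n, iter m par v = iter n par w.

Definition par_adj : rel V := fun v w => (par v == w) || (par w == v).

Lemma par_adj_sym : symmetric par_adj.
Proof. by move=> v w; rewrite /par_adj orbC. Qed.

Lemma par_adj_irr : irreflexive par_adj.
Proof.
by move=> v; rewrite /par_adj orbb; apply/eqP => e; have := ht_par v; rewrite e ltxx.
Qed.

Lemma par_adj_iter m v : exists p, path par_adj v p /\ last v p = iter m par v.
Proof.
elim: m => [|m [p [pp lp]]]; first by exists [::].
by exists (rcons p (par (last v p))); rewrite rcons_path pp last_rcons lp /= /par_adj eqxx.
Qed.

Lemma par_adj_connected v w : exists p, path par_adj v p /\ last v p = w.
Proof.
have [m [n e]] := par_meet v w.
have [p [pp lp]] := par_adj_iter m v; have [q [pq lq]] := par_adj_iter n w.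
exists (p ++ rev (belast w q)); rewrite cat_path pp last_cat lp e -lq; split.
  by rewrite rev_path; apply: sub_path pq => x y; rewrite par_adj_sym.
by case: q pq lq => //= a q _ _; rewrite rev_cons last_rcons.
Qed.

Definition parent_graph := Graph par_adj_sym par_adj_irr par_adj_connected.

Lemma dist_parent m (v : parent_graph) : dist v (iter m par v) <= m.
Proof.
elim: m => [|m IH]; first by rewrite distxx.
apply: leq_trans (dist_triangle (iter m par v : parent_graph) _ _) _.
suff -> : dist (iter m par v : parent_graph) (iter m.+1 par v : parent_graph) = 1 by lia.
by apply: dist_adj; rewrite /= /par_adj eqxx.
Qed.

Lemma dist_parent_meet m n (v w : parent_graph) : iter m par v = iter n par w ->
  dist v w <= m + n.
Proof.
move=> e; apply: leq_trans (dist_triangle (iter m par v : parent_graph) _ _) _.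
by apply: leq_add; [|rewrite e distC]; exact: dist_parent.
Qed.

(** A vertex of maximal height on a cycle can only be adjacent to its parent, so
    its two neighbours on the cycle coincide. *)
Lemma parent_graph_tree : tree parent_graph.
Proof.
case=> // x0 s0; set s := x0 :: s0 => cs us.
have [v vs vmax] : exists2 v, v \in s & {in s, forall w, (ht w <= ht v)%R}.
  rewrite /s; elim: s0 x0 {s cs us} => [|y s IH] x.
    by exists x; rewrite ?mem_head // => w; rewrite inE => /eqP ->.
  have [v vs vmax] := IH y; have [xv|vx] := leP (ht x) (ht v).
    exists v; first by rewrite inE vs orbT.
    by move=> w; rewrite inE => /predU1P[->|/vmax].
  exists x; first exact: mem_head.
  move=> w; rewrite inE => /predU1P[->|/vmax] //.
  by move=> wv; apply: le_trans wv (ltW vx).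
have [i t rt] := rot_to vs.
have ct : cycle par_adj (v :: t) by rewrite -rt rot_cycle.
have ut : uniq (v :: t) by rewrite -rt rot_uniq.
have vmax' : {in t, forall w, (ht w <= ht v)%R}.
  by move=> w wt; apply: vmax; rewrite -(mem_rot i) rt inE wt orbT.
have sz : size s = size (v :: t) by rewrite -rt size_rot.
rewrite sz; clear - ct ut vmax' ht_par.
have nbr w : w \in t -> par_adj v w -> w = par v.
  move=> /vmax' wv /orP[/eqP //|/eqP e].
  by have := ht_par w; rewrite e; lia.
case: t ct ut vmax' nbr => [|a t] // ct ut vmax' nbr.
have av : a = par v by apply: nbr; [exact: mem_head|case/andP: ct].
have zv : last a t = par v.
  apply: nbr; first exact: mem_last.
  by move: ct; rewrite /cycle rcons_path par_adj_sym => /andP[].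
case: t ct ut {vmax' nbr} zv => // c t _ /= /and3P[_ + _] zv.
by rewrite av -zv /= mem_last.
Qed.

Lemma parent_graph_regular (ch : V -> seq V) d :
  (forall v, uniq (ch v)) -> (forall v w, (w \in ch v) = (par w == v)) ->
  (forall v, size (ch v) = d) -> regular d.+1 parent_graph.
Proof.
move=> uch chP szch v.
have un : uniq (par v :: ch v).
  rewrite /= uch andbT chP; apply/eqP => e.
  by have := ht_par (par v); rewrite e; have := ht_par v; lia.
have nbr w : par_adj v w = (w \in par v :: ch v).
  by rewrite inE chP /par_adj eq_sym.
apply/card_set_bijP; exists (index^~ (par v :: ch v)); split.
- by move=> w /=; rewrite nbr -index_mem /= szch.
- move=> w w' /set_mem hw /set_mem hw' e.
  have {}hw : w \in par v :: ch v by rewrite -nbr.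
  have {}hw' : w' \in par v :: ch v by rewrite -nbr.
  by rewrite -(nth_index v hw) e nth_index.
- move=> i /= id; have lt : i < size (par v :: ch v) by rewrite /= szch.
  exists (nth v (par v :: ch v) i); first by rewrite /= nbr mem_nth.
  exact: (index_uniq v lt un).
Qed.

End ParentGraph.

Section ThinHorospheres.
Variables (X : graph) (H : set (X -> X)) (b : X -> int) (up : X -> X) (D : nat).
Hypotheses (lf : locally_finite X) (HG : automorphism_group H).
Hypotheses (Ht : vertex_transitive H) (hF : horofunction H b up D).

(** If levels have bounded diameter, then the level function itself is a
    quasi-isometry onto the integers. *)
Lemma thin_horospheres_line (R : realType) (o : X) R0 :
  (forall x y, b x = b y -> dist x y <= R0) ->
  exists (d : nat) (T : graph), [/\ tree T, regular d T & quasi_isometric R X T].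
Proof.
move=> thin.
pose par (n : int) := (n - 1)%R.
have parI m n : iter m par n = (n - m%:Z)%R.
  by elim: m => [|m IH] /=; rewrite ?IH /par; lia.
have hp n : (par n < n)%R by rewrite /par; lia.
have pm m n : exists a c, iter a par m = iter c par n.
  by exists (absz (m - Num.min m n)%R), (absz (n - Num.min m n)%R); rewrite !parI; lia.
have /choice [g hg] : forall n : int, exists x, b x = n.
  by move=> n; have [q [_ bq _]] := good_near lf HG Ht hF o n; exists q.
exists 2, (parent_graph hp pm); split.
- exact: parent_graph_tree.
- apply: (parent_graph_regular (ch := fun n => [:: (n + 1)%R])) => //.
  by move=> v w; rewrite inE /par; lia.
- have dist_line m n (e : par m = n) : dist (m : parent_graph hp pm) n <= 1.
    by rewrite -e; exact: (@dist_parent _ _ _ hp pm 1).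
  have dg n : dist (g n) (g (par n)) <= R0.+1.
    apply: leq_trans (dist_triangle (up (g n)) _ _) _.
    rewrite (dist_adj (horo_adj hF _)) add1n ltnS; apply: thin.
    by rewrite (horo_up hF) !hg.
  apply: (@quasi_isometric_of_inverse R X (parent_graph hp pm) b g R0.+1).
  + move=> x y xy; have := horo_lip hF x y; have := horo_lip hF y x.
    rewrite distC (dist_adj xy) => h1 h2.
    have [e|[e|e]] : b x = b y \/ par (b x) = b y \/ par (b y) = b x by rewrite /par; lia.
    * by rewrite e distxx.
    * by have := dist_line _ _ e; lia.
    * by rewrite distC; have := dist_line _ _ e; lia.
  + by move=> m n /orP[/eqP <-|/eqP <-]; [|rewrite distC]; exact: dg.
  + by move=> x; apply: leqW; apply: thin; rewrite hg.
  + by move=> n; rewrite hg distxx.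
Qed.

End ThinHorospheres.

(** * Trivalent trees from trees with bounded branching *)

Section Binary.
Variables (V : eqType) (par : V -> V) (ht : V -> int) (ch : V -> seq V) (M : nat).
Hypothesis ht_par : forall v, (ht (par v) < ht v)%R.
Hypothesis par_meet : forall v w, exists m n, iter m par v = iter n par w.
Hypothesis ch_uniq : forall v, uniq (ch v).
Hypothesis chP : forall v w, (w \in ch v) = (par w == v).
Hypothesis ch_size : forall v, 2 <= size (ch v) <= M.

(** A vertex [v] with [m] children is replaced by a comb with [m - 1] vertices
    [(v, 0)], ..., [(v, m - 2)], each the parent of the next one.  The vertex
    [(v, i)] also becomes the parent of the [i]-th child of [v], and the last
    one of the last child in addition; so each has exactly two children. *)
Definition comb_pred (p : V * nat) := p.2.+1 < size (ch p.1).
Definition comb := {p : V * nat | comb_pred p}.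
Implicit Types p q : comb.

(** The [minn] attaches the last two children of a vertex to the last vertex
    of its comb. *)
Definition comb_par_raw (p : V * nat) : V * nat :=
  if p.2 is i.+1 then (p.1, i)
  else (par p.1, minn (index p.1 (ch (par p.1))) (size (ch (par p.1)) - 2)).

Lemma comb_parP p : comb_pred (comb_par_raw (val p)).
Proof.
case: p => -[v [|i]]; rewrite /comb_pred /comb_par_raw /=.
  by have := ch_size (par v); lia.
lia.
Qed.

Definition comb_par p : comb := Sub _ (comb_parP p).

Lemma comb_index_lt p : (val p).2 < M.
Proof.
by case: p => -[v i]; rewrite /comb_pred /= => h; have := ch_size v; move: h; lia.
Qed.

Lemma comb_rootP v : comb_pred (v, 0).
Proof. by rewrite /comb_pred /=; have := ch_size v; lia. Qed.

Definition comb_root v : comb := Sub _ (comb_rootP v).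

(** Combs have fewer than [M] vertices, so this increases both along combs
    and from combs to combs below. *)
Definition comb_ht p : int := (M%:Z * ht (val p).1 + (val p).2%:Z)%R.

Lemma comb_ht_par p : (comb_ht (comb_par p) < comb_ht p)%R.
Proof.
rewrite /comb_ht /=; case: p => -[v [|i]] /= h; last by rewrite /comb_par_raw /=; lia.
have := ht_par v; have := ch_size (par v); rewrite /comb_par_raw /=; nia.
Qed.

Lemma comb_iter_root p : iter (val p).2 comb_par p = comb_root (val p).1.
Proof.
case: p => -[v i] /=; elim: i => [|i IH] h; first exact: val_inj.
have h' : comb_pred (v, i) by move: h; rewrite /comb_pred /=; lia.
by rewrite iterSr -(IH h'); congr iter; apply: val_inj.
Qed.

Lemma comb_iter_par v : exists2 n, n <= M & iter n comb_par (comb_root v) = comb_root (par v).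
Proof.
exists (val (comb_par (comb_root v))).2.+1.
  exact: comb_index_lt.
by rewrite iterSr comb_iter_root.
Qed.

Lemma comb_iter_iter m v :
  exists2 n, n <= m * M & iter n comb_par (comb_root v) = comb_root (iter m par v).
Proof.
elim: m => [|m [n nm e]]; first by exists 0.
have [n' nm' e'] := comb_iter_par (iter m par v).
by exists (n' + n); rewrite ?iterD ?e ?e' // mulSn leq_add.
Qed.

Lemma comb_meet p q : exists m n, iter m comb_par p = iter n comb_par q.
Proof.
have [m [n e]] := par_meet (val p).1 (val q).1.
have [m' _ em] := comb_iter_iter m (val p).1; have [n' _ en] := comb_iter_iter n (val q).1.
exists (m' + (val p).2), (n' + (val q).2).
by rewrite !iterD !comb_iter_root em en e.
Qed.

Definition comb_child2_raw (p : V * nat) : V * nat :=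
  if p.2.+2 < size (ch p.1) then (p.1, p.2.+1) else (nth p.1 (ch p.1) p.2.+1, 0).

Lemma comb_child2P p : comb_pred (comb_child2_raw (val p)).
Proof.
rewrite /comb_child2_raw; case: ifP => // _; exact: comb_rootP.
Qed.

Definition comb_ch p : seq comb :=
  [:: comb_root (nth (val p).1 (ch (val p).1) (val p).2); Sub _ (comb_child2P p)].

Lemma comb_ch_uniq p : uniq (comb_ch p).
Proof.
rewrite /= inE andbT -val_eqE /= /comb_child2_raw; case: p => -[v i] /= h.
case: ifP => lt; rewrite xpair_eqE /=; first by rewrite andbF.
rewrite andbT nth_uniq //; first by rewrite neq_ltn leqnn.
by move: h; rewrite /comb_pred /=; lia.
Qed.

Lemma comb_chP p q : (q \in comb_ch p) = (comb_par q == p).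
Proof.
rewrite !inE -!val_eqE /= /comb_child2_raw /comb_par_raw.
case: p q => -[v i] /= hv [[w [|j]]] /= hw; rewrite /comb_pred /= in hv hw.
  have -> : (w, 0) == (if i.+2 < size (ch v) then (v, i.+1) else (nth v (ch v) i.+1, 0))
     = (i.+2 == size (ch v)) && (w == nth v (ch v) i.+1).
    case: ifP => lt; rewrite xpair_eqE ?andbF ?andbT.
      by rewrite (_ : _ == _ = false) //; lia.
    by rewrite (_ : i.+2 == _) //; lia.
  rewrite !xpair_eqE eqxx andbT.
  case: (eqVneq (par w) v) => [pw|nv] /=.
    subst v.
    have wp : w \in ch (par w) by rewrite chP.
    have wi : index w (ch (par w)) < size (ch (par w)) by rewrite index_mem.
    have eqn k : k < size (ch (par w)) ->
        (w == nth (par w) (ch (par w)) k) = (index w (ch (par w)) == k).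
      move=> kw; apply/eqP/eqP => [e|<-]; first by rewrite {1}e index_uniq.
      by rewrite nth_index.
    by rewrite !eqn //; lia.
  have nn k : k < size (ch v) -> (w == nth v (ch v) k) = false.
    by move=> kv; apply: contraNF nv => /eqP ->; rewrite -chP mem_nth.
  rewrite !nn ?andbF //; lia.
have -> : (w, j.+1) == (nth v (ch v) i, 0) = false by rewrite xpair_eqE andbF.
rewrite /=; case: ifP => lt; rewrite !xpair_eqE ?eqSS //.
rewrite andbF; apply/esym/negP => /andP[/eqP e /eqP ij]; move: hw; rewrite e ij lt //.
Qed.

Definition comb_graph := parent_graph comb_ht_par comb_meet.

Lemma comb_graph_regular : regular 3 comb_graph.
Proof. by apply: parent_graph_regular comb_ch_uniq comb_chP _. Qed.

Lemma comb_quasi_isometric (R : realType) (X : graph) (F : X -> V) (G : V -> X) N :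
  (forall x y, adj x y -> exists m n, [/\ m <= N, n <= N & iter m par (F x) = iter n par (F y)]) ->
  (forall v, dist (G v) (G (par v)) <= N) ->
  (forall x, dist (G (F x)) x <= N) -> (forall v, F (G v) = v) ->
  quasi_isometric R X comb_graph.
Proof.
move=> FN GN GF FG.
have NK : N <= N + M + 2 * N * M by rewrite -addnA leq_addr.
have MK : M <= N + M + 2 * N * M by rewrite addnAC leq_addl.
apply: (@quasi_isometric_of_inverse R X comb_graph (fun x => comb_root (F x))
   (fun p : comb => G (val p).1) (N + M + 2 * N * M)).
- move=> x y /FN[m [n [mN nN e]]].
  have [m' hm em] := comb_iter_iter m (F x); have [n' hn en] := comb_iter_iter n (F y).
  have : dist (comb_root (F x) : comb_graph) (comb_root (F y)) <= m' + n'.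
    by apply: dist_parent_meet; rewrite em en e.
  by move=> h; apply: leq_trans h _; nia.
- have half p : dist (G (val p).1) (G (val (comb_par p)).1) <= N.
    by case: p => -[v [|i]] h; rewrite /= /comb_par_raw //= distxx.
  move=> v w /orP[/eqP <-|/eqP <-]; last rewrite distC.
    exact: leq_trans (half v) NK.
  exact: leq_trans (half w) NK.
- by move=> x; exact: leq_trans (GF x) NK.
- move=> p; rewrite FG distC -comb_iter_root.
  have := @dist_parent _ _ _ comb_ht_par comb_meet (val p).2 p.
  by move=> h; apply: leq_trans h (leq_trans _ MK); exact: ltnW (comb_index_lt p).
Qed.

End Binary.

(** * The tree of horospherical components *)

(** A list of maximal length among the duplicate-free ones is complete. *)
Lemma enumerate_bounded (T : eqType) (P : T -> Prop) M :
  (forall s : seq T, uniq s -> {in s, forall x, P x} -> size s <= M) ->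
  exists s : seq T, uniq s /\ forall x, x \in s <-> P x.
Proof.
move=> bd.
pose Q k := `[< exists s : seq T, [/\ uniq s, {in s, forall x, P x} & size s = k] >].
have exQ : exists k, Q k by exists 0; apply/asboolP; exists [::].
have leQ k : Q k -> k <= M by move=> /asboolP[s [us sP <-]]; exact: bd.
case: (ex_maxnP exQ leQ) => k /asboolP[s [us sP <-]] kmax; exists s; split => // x.
split; first exact: sP.
move=> Px; apply: contrapT => /negP xs.
suff /kmax : Q (size s).+1 by rewrite ltnn.
apply/asboolP; exists (x :: s); split; rewrite //= ?xs //.
by move=> y; rewrite inE => /predU1P[->|/sP].
Qed.

(** The representative is chosen in the class as a set, so that equivalent
    points get the same one. *)
Lemma class_representative (T : Type) (E : T -> T -> Prop) :
  (forall x, E x x) -> (forall x y, E x y -> E y x) ->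
  (forall y x z, E x y -> E y z -> E x z) ->
  exists rep : T -> T, (forall x, E x (rep x)) /\ forall x y, E x y -> rep x = rep y.
Proof.
move=> Er Es Et.
have /choice [F hF] : forall S : {S : set T | exists x, S x}, exists y, sval S y by case.
exists (fun x => F (exist _ (E x) (ex_intro _ x (Er x)))); split.
  by move=> x; exact: hF (exist _ (E x) _).
move=> x y xy; congr F; apply/eq_exist/seteqP; split => z /=.
  exact: Et (Es _ _ xy).
exact: Et xy.
Qed.

Section WideHorospheres.
Variables (X : graph) (H : set (X -> X)) (b : X -> int) (up : X -> X) (D : nat).
Hypotheses (lf : locally_finite X) (HG : automorphism_group H).
Hypotheses (Ht : vertex_transitive H) (hF : horofunction H b up D).
Implicit Types (x y z p q : X) (f u : X -> X).

Let biter := b_iter hF.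
Let diter := dist_iter hF.
Let dist_auto f x y := @auto_dist X H f x y HG.

Hypothesis wide : forall R0, exists x y, b x = b y /\ R0 < dist x y.

(** Two points [x] and [y] of one level that are far apart have a common
    approximate ancestor [p] at distance [m].  Carrying [p] to [z] and descending
    [j] further levels gives two points below [z]; if these were at distance at most
    [B <= j], their ancestors near the images of [x] and [y] would have
    merged. *)
Lemma uniform_branching B : exists k0, forall j z, B <= j ->
  exists z1 z2, [/\ b z1 = (b z + (k0 + j)%:Z)%R, b z2 = (b z + (k0 + j)%:Z)%R,
    dist (iter (k0 + j) up z1) z <= 5 * D, dist (iter (k0 + j) up z2) z <= 5 * D &
    B < dist z1 z2].
Proof.
(* Replacing the images of [x] and [y] by good points costs [6 * D]; the
   remaining [2 * D] is what merged lines cannot exceed. *)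
have [x [y [bxy xy]]] := wide (8 * D).
set m := dist x y in xy *; exists m => j z Bj.
have [f Hf fp] := Ht (iter m up x) z.
have px := above_iter hF m x.
have py : above b D (iter m up x) y.
  by apply: (above_push hF (C := 0) px); rewrite biter; lia.
have fx := b_auto hF x (iter m up x) Hf; have fy := b_auto hF y (iter m up x) Hf.
have dx := dist_auto (iter m up x) x Hf; have dy := dist_auto (iter m up x) y Hf.
rewrite fp !biter in fx fy dx dy; rewrite /above biter in px py.
have [x1 [gx1 bx1 dx1]] := good_near lf HG Ht hF (f x) (b z + m%:Z)%R.
have [y1 [gy1 by1 dy1]] := good_near lf HG Ht hF (f y) (b z + m%:Z)%R.
have zx1 : above b (4 * D) z x1.
  by rewrite /above; have := dist_triangle (f x) z x1; rewrite (distC (f x)); lia.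
have zy1 : above b (4 * D) z y1.
  by rewrite /above; have := dist_triangle (f y) z y1; rewrite (distC (f y)); lia.
have far : 2 * D < dist x1 y1.
  have := dist_triangle x1 (f x) (f y); have := dist_triangle y1 x1 (f y).
  by rewrite (distC (f x) x1) (dist_auto _ _ Hf); lia.
have [z1 z1x _] := good_desc lf hF j gx1; have [z2 z2y _] := good_desc lf hF j gy1.
have bz1 := biter j z1; have bz2 := biter j z2; rewrite z1x bx1 in bz1; rewrite z2y by1 in bz2.
exists z1, z2; split; [lia|lia| | |].
- rewrite iterD z1x; have := above_merge hF (aboveW (leq0n _) (above_iter hF m x1)) zx1.
  by rewrite biter; lia.
- rewrite iterD z2y; have := above_merge hF (aboveW (leq0n _) (above_iter hF m y1)) zy1.
  by rewrite biter; lia.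
- rewrite ltnNge; apply/negP => zz.
  have := @iter_close X H b up D hF j j z1 z2; rewrite z1x z2y bx1 by1; lia.
Qed.

(** The two points that [uniform_branching] finds below [z] have ancestors
    within [5 * D] of [z]; steps of this length put them in the component of
    [z].  Ancestors of nearby points, which are within [2 * D], are joined as
    well. *)
Definition mesh := 5 * D + 1.
Definition horochain x y := exists s, path (horostep b mesh) x s /\ last x s = y.

Lemma horochain_refl x : horochain x x.
Proof. by exists [::]. Qed.

Lemma horochain_sym x y : horochain x y -> horochain y x.
Proof.
case=> s [ps ls]; exists (rev (belast x s)); split.
  rewrite -ls rev_path; apply: sub_path ps => a c.
  by rewrite /horostep distC eq_sym.
by case: s ps ls => //= a s _ _; rewrite rev_cons last_rcons.
Qed.

Lemma horochain_trans y x z : horochain x y -> horochain y z -> horochain x z.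
Proof.
by case=> s [ps ls] [t [pt lt]]; exists (s ++ t); rewrite cat_path ps last_cat ls pt.
Qed.

Lemma horochain_level x y : horochain x y -> b y = b x.
Proof.
case=> s [/horopath_level h <-].
by have := mem_last x s; rewrite inE => /predU1P[->|/h].
Qed.

Lemma horochain_close x y : b x = b y -> dist x y <= mesh -> horochain x y.
Proof. by move=> bxy dxy; exists [:: y]; rewrite /= /horostep dxy bxy eqxx. Qed.

Lemma horochain_iter k x y : mesh <= k -> horochain x y -> horochain (iter k up x) (iter k up y).
Proof.
move=> rk [s [ps <-]]; exists (map (iter k up) s); split; last by rewrite last_map.
rewrite path_map; apply: sub_path ps => v w /andP[vw /eqP bvw] /=.
rewrite /horostep !biter bvw eqxx andbT.
by have := @iter_close X H b up D hF k k v w; rewrite !biter /mesh in vw rk *; lia.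
Qed.

(** The tree has as vertices the components, for [horochain], of the levels in
    [k Z]; a component is encoded by its canonical point.  The parent of the
    component of [x] is that of [iter k up x], and the map from X sends [x]
    to the component of the first ancestor of [x] at a level in [k Z].  The
    number of children is bounded because components are. *)
Lemma wide_horospheres_tree (R : realType) :
  exists (d : nat) (T : graph), [/\ tree T, regular d T & quasi_isometric R X T].
Proof.
have [B hB] := horopath_bounded lf HG Ht hF mesh.
have horochainB x y : horochain x y -> dist x y <= B.
  case=> s [ps <-]; have := mem_last x s; rewrite inE => /predU1P[->|/(hB _ _ ps) //].
  by rewrite distxx.
have [k rk branch] : exists2 k, mesh <= k & forall z, exists z1 z2,
    [/\ b z1 = (b z + k%:Z)%R, b z2 = (b z + k%:Z)%R,
        dist (iter k up z1) z <= 5 * D, dist (iter k up z2) z <= 5 * D & B < dist z1 z2].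
  have [k0 h] := uniform_branching B; exists (k0 + (B + mesh)); first by lia.
  by move=> z; apply: h; lia.
have k_gt0 : 0 < k by move: rk; rewrite /mesh; lia.
have [ o [_ [_ _]]] := wide 0.
have [rep [horochain_rep rep_eq]] :=
  class_representative horochain_refl horochain_sym horochain_trans.
have rep_rep x : rep (rep x) = rep x by apply/esym/rep_eq.
have b_rep x : b (rep x) = b x by exact: horochain_level.
have rep_iter n x : rep (iter (n * k) up (rep x)) = rep (iter (n * k) up x).
  elim: n x => [|n IH] x; first exact: rep_rep.
  rewrite mulSn addnC !iterD -IH -[RHS]IH; congr (rep (iter _ _ _)).
  by apply/esym/rep_eq; exact: horochain_iter rk (horochain_rep x).
pose V := {x : X | (rep x == x) && (Posz k %| b x)%Z}.
have mkV x : (Posz k %| b x)%Z -> exists v : V, val v = rep x.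
  move=> kx; have h : (rep (rep x) == rep x) && (Posz k %| b (rep x))%Z.
    by rewrite rep_rep eqxx b_rep.
  by exists (Sub (rep x) h).
have repV (v : V) : rep (val v) = val v by case/andP: (valP v) => /eqP.
have levV (v : V) : (Posz k %| b (val v))%Z by case/andP: (valP v).
pose rem x := absz (b x %% Posz k)%Z.
have bE x : b x = ((b x %/ Posz k)%Z * k%:Z + (rem x)%:Z)%R /\ rem x < k.
  have := divz_eq (b x) (Posz k); have := modz_ge0 (b x) (d := Posz k).
  by have := ltz_mod (b x) (d := Posz k); rewrite /rem; lia.
have lev_rem x : b (iter (rem x) up x) = ((b x %/ Posz k)%Z * k%:Z)%R.
  by rewrite biter; have := (bE x).1; lia.
have /choice [cls hcls] : forall x, exists v : V, val v = rep (iter (rem x) up x).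
  by move=> x; apply: mkV; rewrite lev_rem dvdz_mull.
have /choice [par hpar] : forall v : V, exists w : V, val w = rep (iter k up (val v)).
  by move=> v; apply: mkV; rewrite biter rpredB ?levV.
have cls_level x : (Posz k %| b x)%Z -> val (cls x) = rep x.
  by move=> kx; rewrite hcls /rem; have -> : (b x %% Posz k)%Z = 0%R by exact/dvdz_mod0P.
have iter_par n v : val (iter n par v) = rep (iter (n * k) up (val v)).
  elim: n => [|n IH] /=; first by rewrite repV.
  by rewrite hpar IH -{1}(mul1n k) rep_iter -iterD mul1n mulSn.
have cls_val v : cls (val v) = v.
  by apply: val_inj; rewrite cls_level ?levV.
have cls_adj x y : adj x y ->
    exists m n, [/\ m <= 2, n <= 2 & iter m par (cls x) = iter n par (cls y)].
  (* One or two further steps of length [k] bring both lines to a common level,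
     at least [k >= dist x y] above [x], where they have merged. *)
  move=> xy; suff [m [n [m2 n2 m1 e]]] : exists m n,
      [/\ m <= 2, n <= 2, 0 < m & b (iter (m * k + rem x) up x) = b (iter (n * k + rem y) up y)].
    exists m, n; split => //; apply: val_inj; rewrite !iter_par !hcls !rep_iter -!iterD.
    apply: rep_eq; apply: horochain_close => //; apply: leq_trans (iter_close hF e _) _.
      by rewrite (dist_adj xy); nia.
    by rewrite /mesh; lia.
  have [ex rx] := bE x; have [ey ry] := bE y.
  have := horo_lip hF x y; have := horo_lip hF y x; rewrite distC (dist_adj xy).
  set qx := (b x %/ _)%Z in ex; set qy := (b y %/ _)%Z in ey => h1 h2.
  have [e|[e|e]] : qx = qy \/ qx = (qy + 1)%R \/ qy = (qx + 1)%R by nia.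
  - by exists 1, 1; split => //; rewrite !biter ex ey e; lia.
  - by exists 2, 1; split => //; rewrite !biter ex ey e; lia.
  - by exists 1, 2; split => //; rewrite !biter ex ey e; lia.
have par_meet v w : exists m n, iter m par v = iter n par w.
  have [p [pp lp]] := graph_connected (val v) (val w).
  rewrite -(cls_val v) -(cls_val w) -lp.
  elim: p (val v) pp {lp} => [|y p IH] x /=; first by exists 0, 0.
  move=> /andP[/cls_adj[m [n [_ _ e]]] /IH[m' [n' e']]].
  by exists (m' + m), (n + n'); rewrite iterD e -iterD addnC iterD e' -iterD addnC.
pose ht (v : V) := b (val v).
have ht_par v : (ht (par v) < ht v)%R by rewrite /ht hpar b_rep biter; lia.
have par_near w : dist (val (par w)) (val w) <= k + B.
  rewrite hpar; have := dist_triangle (iter k up (val w)) (val w) (rep (iter k up (val w))).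
  by rewrite diter distC; have := horochainB _ _ (horochain_rep (iter k up (val w))); lia.
have [M hM] := ball_bound lf HG Ht o (k + B).
have /choice [ch hch] : forall v, exists s : seq V, uniq s /\ forall w, w \in s <-> par w = v.
  move=> v; apply: (@enumerate_bounded _ _ M) => s us sP.
  rewrite -(size_map val); apply: (hM (val v)).
    by rewrite map_inj_uniq //; exact: val_inj.
  by move=> _ /mapP[w ws ->]; rewrite -(sP w ws); exact: par_near.
have ch_uniq v : uniq (ch v) by case: (hch v).
have chP v w : (w \in ch v) = (par w == v).
  by apply/idP/eqP => /(hch v).2.
have ch_size v : 2 <= size (ch v) <= M.
  apply/andP; split; last first.
    rewrite -(size_map val); apply: (hM (val v)).
      by rewrite map_inj_uniq ?ch_uniq //; exact: val_inj.
    by move=> y /mapP[w wv ->]; move: wv; rewrite chP => /eqP <-; exact: par_near.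
  have [z1 [z2 [b1 b2 d1 d2 far]]] := branch (val v).
  have kz z : b z = (b (val v) + k%:Z)%R -> (Posz k %| b z)%Z.
    by move=> ->; rewrite rpredD ?levV.
  have in_ch z : b z = (b (val v) + k%:Z)%R -> dist (iter k up z) (val v) <= 5 * D ->
      cls z \in ch v.
    move=> bz dz; rewrite chP; apply/eqP/val_inj.
    rewrite hpar cls_level ?kz // -{1}(mul1n k) rep_iter mul1n -(repV v).
    by apply/rep_eq/horochain_close; rewrite ?biter ?bz ?/mesh; lia.
  have : uniq [:: cls z1; cls z2].
    rewrite /= inE andbT; apply/eqP => /(congr1 val); rewrite !cls_level ?kz // => e.
    have : dist z1 z2 <= B; last by lia.
    apply: horochainB; apply: horochain_trans (horochain_rep z1) _; rewrite e.
    exact/horochain_sym.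
  move=> /uniq_leq_size; apply => w; rewrite !inE => /orP[] /eqP ->; exact: in_ch.
exists 3, (comb_graph ht_par par_meet ch_size); split.
- exact: parent_graph_tree.
- exact: comb_graph_regular.
- apply: (@comb_quasi_isometric _ _ _ _ _ ht_par par_meet ch_size R X cls val (2 + (k + B))).
  + move=> x y /cls_adj[m [n [m2 n2 e]]]; exists m, n; split => //; lia.
  + by move=> v; rewrite distC; apply: leq_trans (par_near v) _; lia.
  + move=> x; rewrite hcls distC; apply: leq_trans (dist_triangle (iter (rem x) up x) _ _) _.
    rewrite diter; have := horochainB _ _ (horochain_rep (iter (rem x) up x)).
    by have := (bE x).2; lia.
  + exact: cls_val.
Qed.

End WideHorospheres.

Theorem corollary3 (R : realType) (X : graph) (H : set (X -> X))
    (xi : set (nat -> X)) :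
  locally_finite X ->
  hyperbolic R X ->
  automorphism_group H ->
  vertex_transitive H ->
  boundary R X xi ->
  fixes_at_infinity H xi ->
  (exists (d : nat) (T : graph),
     [/\ tree T, regular d T & quasi_isometric R X T]) /\
  ~ one_ended X.
Proof.
move=> lf hyp HG Ht bd fix_xi.
have [b [up [D hF]]] := focal_horofunction lf hyp HG bd fix_xi.
have [ o _ _] := bd; split; last exact: not_one_ended lf HG Ht hF (o 0).
have [[R0 thin]|wide] := EM (exists R0, forall x y, b x = b y -> dist x y <= R0).
  exact: (thin_horospheres_line lf HG Ht hF R (o 0) thin).
apply: (wide_horospheres_tree lf HG Ht hF) => R0.
apply: contrapT => no; apply: wide; exists R0 => x y bxy.
by rewrite leqNgt; apply/negP => far; apply: no; exists x, y.
Qed.
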